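(* Let $n\ge5$ and let $S_n\in\mathbb{S}_n$ satisfy $R_n\Rightarrow S_n$, with sorted non-decreasing codeword length sequence $(l_1,\dots,l_n)$. If $\sum_{i=1}^n l_i<n(n+1)/2$, then $S_n\in\mathbb{D}_n$.
   Context: All strings are finite binary strings; $|w|$ denotes length. A palindrome is a string equal to its reversal. A symmetric fix-free code is a finite set of binary palindromes no one of which is a proper prefix of another. $\mathbb{S}_n$ is the set of symmetric fix-free codes with exactly $n$ codewords which do not contain the string $1$ and all of whose codewords have length at most $n$. $R_n=\{s_1,\dots,s_n\}$ with $s_1=0$ and $s_i=1\,0^{i-2}\,1$ for $2\le i\le n$. For a palindrome $\sigma$, $\mathcal{N}(\sigma)$ is the set of palindromes $w$ such that $\sigma$ is the longest palindrome that is a proper prefix of $w$, and $\mathcal{N}_n(\sigma)=\{w\in\mathcal{N}(\sigma):|w|\le n\}$. $R_n\Rightarrow S$ means: for some $j$, $S$ is an $n$-element subset of $(R_n\cup\mathcal{N}_n(s_j))\setminus\{s_j\}$ such that no word of that set outside $S$ is shorter than any word of $S$. A sorted non-decreasing length sequence $(l_1,\dots,l_n)$ dominates $(l_1',\dots,l_n')$ if $\sum_{j=1}^i l_j'\ge\sum_{j=1}^i l_j$ for every $i\in\{1,\dots,n\}$. $\mathbb{D}_n\subseteq\mathbb{S}_n$ is the set of codes in $\mathbb{S}_n$ whose sorted non-decreasing codeword length sequence is not dominated by the sorted non-decreasing codeword length sequence of any other code in $\mathbb{S}_n$ (with a different length sequence). *)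

(* Defs.v *)
(* Binary strings are [seq bool] with
   [false] = 0 and [true] = 1.  A finite set of strings (a code) is a
   duplicate-free list [seq (seq bool)]. *)
From mathcomp Require Import all_boot.
Set Implicit Arguments. Unset Strict Implicit. Unset Printing Implicit Defensive.

Definition word := seq bool.

Definition palindrome (w : word) : bool := rev w == w.

Definition proper_prefix (u w : word) : bool := prefix u w && (size u < size w).

Definition sym_fix_free (S : seq word) : bool :=
  uniq S && all palindrome S &&
  [forall i : 'I_(size S), forall j : 'I_(size S),
      ~~ proper_prefix (nth [::] S i) (nth [::] S j)].

Definition in_Sn (n : nat) (S : seq word) : bool :=
  [&& sym_fix_free S, size S == n, [:: true] \notin S
    & all (fun w => size w <= n) S].

Definition s_ (i : nat) : word :=
  if i <= 1 then [:: false] else true :: rcons (nseq (i - 2) false) true.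

Definition R_ (n : nat) : seq word := [seq s_ i | i <- iota 1 n].

Definition in_N (sigma w : word) : Prop :=
  palindrome w /\ palindrome sigma /\ proper_prefix sigma w /\
  (forall u : word, palindrome u -> proper_prefix u w -> size u <= size sigma).

Definition in_Nn (n : nat) (sigma w : word) : Prop :=
  in_N sigma w /\ size w <= n.

Definition R_implies (n : nat) (S : seq word) : Prop :=
  exists j : nat, 1 <= j <= n /\
    let T := fun w : word => (w \in R_ n \/ in_Nn n (s_ j) w) /\ w <> s_ j in
    [/\ uniq S, size S = n,
        (forall w, w \in S -> T w) &
        (forall u, T u -> u \notin S -> forall w, w \in S -> size w <= size u)].

Definition lengths (S : seq word) : seq nat := sort leq (map size S).

Definition dominates (n : nat) (l l' : seq nat) : Prop :=
  forall i, 1 <= i <= n -> sumn (take i l) <= sumn (take i l').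

Definition in_Dn (n : nat) (S : seq word) : Prop :=
  in_Sn n S /\
  forall S' : seq word, in_Sn n S' -> lengths S' <> lengths S ->
    ~ dominates n (lengths S') (lengths S).

(* Main.v *)
(* Let C(m), C'(m) count the words of length at most m in S, S'.  The sum of the i
   smallest lengths of S is sum_m max(0, i - C(m)).  Palindromes ordered by "is a prefix
   of" form a forest in which [in_N] is the child relation, and every word of a code in
   [in_Sn n] lies above some [s_ p].  Let S' dominate S, where S comes from expanding s_j.

   At the first m with C(m) <> C'(m) we have C'(m) > C(m); as S takes every available word
   as early as possible, this forces s_1, ..., s_j to be in S'.  Take the least i for which
   the i smallest lengths of S sum to less than i(i+1)/2, and let M be the i-th smallest
   length; minimality of i gives sum_(m<M) C(m) <= sum_(m<M) m and hence M <= 3j.  In this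
   range the words of S' above s_p, for p > j and s_p not in S', are no more numerous than
   the children of s_j, because deleting p - j zeros next to both ends maps them
   injectively to children of s_j.  The first child of s_p has length 2p - 1, so s_p pays
   its removal back later than s_j does, which contradicts domination at i.  The case
   j = 1 is separate: there i = 5 works by inspection. *)
Require Import Defs.
From mathcomp Require Import all_boot zify.
Set Implicit Arguments. Unset Strict Implicit. Unset Printing Implicit Defensive.

(* [lia] takes [size] at [word], [seq bool] and [Equality.sort bool] for distinct atoms. *)
Ltac size_lia := unfold word in *; simpl in *; lia.

(** * Prefix sums of sorted lengths as sums of counting functions *)

Lemma sum_ltn_minn x L : \sum_(m < L) (m < x) = minn x L.
Proof.
elim: L => [|L IH]; first by rewrite big_ord0 minn0.
by rewrite big_ord_recr /= IH; case: ltnP; lia.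
Qed.

(** If one of the [i] smallest entries exceeds [m], all entries at most [m] lie among those [i];
    otherwise both sides vanish. *)
Lemma subn_count_take_sort (s : seq nat) i m : i <= size s ->
  i - count (fun x => x <= m) s =
  count (fun x => m < x) (take i (sort leq s)).
Proof.
move=> les; have szt : size (take i (sort leq s)) = i.
  by rewrite size_takel // size_sort.
rewrite -(count_sort leq (fun x => x <= m) s) -{1}(cat_take_drop i (sort leq s)) count_cat.
have := count_predC (fun x => x <= m) (take i (sort leq s)); rewrite szt.
have -> : count (predC (fun x => x <= m)) (take i (sort leq s)) =
    count (fun x => m < x) (take i (sort leq s)).
  by apply: eq_count => x /=; rewrite -ltnNge.
have [/hasP[x xt mx]|] := boolP (has (fun x => m < x) (take i (sort leq s))).
  suff -> : count (fun x => x <= m) (drop i (sort leq s)) = 0 by lia.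
  apply/eqP; rewrite -leqn0 leqNgt -has_count; apply/hasPn => y yd.
  rewrite -ltnNge (leq_trans mx) //.
  have := sort_sorted leq_total s.
  rewrite sorted_pairwise; last exact: leq_trans.
  rewrite -{1}(cat_take_drop i (sort leq s)) pairwise_cat => /andP[/allrelP h _].
  exact: h.
by rewrite has_count -leqNgt; lia.
Qed.

Lemma sum_subn_count (s : seq nat) i L : i <= size s ->
  \sum_(m < L) (i - count (fun x => x <= m) s) =
  \sum_(x <- take i (sort leq s)) minn x L.
Proof.
move=> les; rewrite (eq_bigr (fun m : 'I_L => \sum_(x <- take i (sort leq s)) (m < x))).
  rewrite exchange_big /=; apply: eq_bigr => x _; exact: sum_ltn_minn.
move=> m _; rewrite (@subn_count_take_sort s i m les) -sum1_count big_mkcond /=.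
by apply: eq_bigr => x _; case: ltnP.
Qed.

Definition cnt (S : seq word) (m : nat) : nat := count (fun w => size w <= m) S.

Lemma cnt_lengths S m : cnt S m = count (fun x => x <= m) (map size S).
Proof. by rewrite count_map. Qed.

Lemma leq_prefix_sum S i L : i <= size S ->
  \sum_(m < L) (i - cnt S m) <= sumn (take i (lengths S)).
Proof.
move=> les; under eq_bigr => m _ do rewrite cnt_lengths.
rewrite sum_subn_count ?size_map // sumnE.
by apply: leq_sum => x _; apply: geq_minl.
Qed.

(** Once [i] words have length at most [L], the [i] smallest lengths do not exceed [L], so
    truncating them at [L] loses nothing. *)
Lemma prefix_sum_eq S i L : i <= size S -> i <= cnt S L ->
  sumn (take i (lengths S)) = \sum_(m < L) (i - cnt S m).
Proof.
move=> les leL; under [RHS]eq_bigr => m _ do rewrite cnt_lengths.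
rewrite sum_subn_count ?size_map // sumnE big_seq [RHS]big_seq.
apply: eq_bigr => x xt; apply/esym/minn_idPl.
have := @subn_count_take_sort (map size S) i L; rewrite size_map -cnt_lengths.
move=> /(_ les) /esym /eqP; move: leL; rewrite -subn_eq0 => /eqP ->.
by rewrite -leqn0 leqNgt -has_count => /hasPn/(_ _ xt); rewrite -leqNgt.
Qed.

Lemma leq_cnt S m k : m <= k -> cnt S m <= cnt S k.
Proof. by move=> le; apply: sub_count => w /= h; apply: leq_trans h le. Qed.

Lemma cnt_size S m : cnt S m <= size S. Proof. exact: count_size. Qed.

Lemma cnt_all n S m : all (fun w => size w <= n) S -> n <= m -> cnt S m = size S.
Proof.
move=> /allP h le; apply/eqP; rewrite /cnt -all_count; apply/allP => w /h.
by move/leq_trans; apply.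
Qed.

(** The multiplicity of a length is the jump of [cnt] there. *)
Lemma eq_cnt_lengths S S' : cnt S =1 cnt S' -> lengths S = lengths S'.
Proof.
move=> h; apply/perm_sortP; [exact: leq_total | exact: leq_trans | exact: anti_leq |].
apply/allP => x _ /=; apply/eqP.
have e (s : seq word) m : count_mem m (map size s) + count (fun y => y < m) (map size s)
     = cnt s m.
  by rewrite cnt_lengths; elim: (map size s) => //= y t <-; lia.
have eS := e S x; have eS' := e S' x; have := h x; rewrite -eS -eS'.
case: x {eS eS'} => [|x].
  have z t : count (fun y => y < 0) t = 0 by elim: t.
  by rewrite !z !addn0.
have c t : count (fun y => y < x.+1) (map size t) = cnt t x by rewrite cnt_lengths.
by rewrite !c (h x) => /addIn.
Qed.

(** * The numerical contradiction *)

Lemma double_sum_ord k : (\sum_(m < k) m).*2 = k * k.-1.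
Proof. by elim: k => [|k IH]; rewrite ?big_ord0 // big_ord_recr /= doubleD IH; nia. Qed.

Lemma double_sum_ord_add k : (\sum_(m < k) m).*2 + k = k * k.
Proof. by rewrite double_sum_ord; nia. Qed.

Lemma sum_nat_rev M : \sum_(1 <= p < M) (M - p) = \sum_(m < M) m.
Proof.
case: M => [|k]; first by rewrite big_geq // big_ord0.
rewrite big_add1 big_mkord [RHS](reindex_inj rev_ord_inj) big_ord_recr /= subnn addn0.
by apply: eq_bigr.
Qed.

Lemma sum_leq_ord a M : \sum_(m < M) (a <= m) = M - a.
Proof.
by elim: M => [|M IH]; rewrite ?big_ord0 // big_ord_recr /= IH; case: (leqP a M); lia.
Qed.

Lemma sum_interval_leq a b M : \sum_(m < M) (a <= m < b) <= b - a.
Proof.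
suff -> : \sum_(m < M) (a <= m < b) = minn M b - minn M a by lia.
elim: M => [|M IH]; rewrite ?big_ord0 ?min0n // big_ord_recr /= IH.
by case: (leqP a M); case: (ltnP M b); lia.
Qed.

(* [c p m] stands for the number of words of length at most [m] above s_p in the dominating
   code, and [b p] for the presence of s_p itself. *)
Lemma no_dominating_counts (n j M i : nat) (C C' : nat -> nat) (c : nat -> nat -> nat)
    (b : pred nat) :
  2 <= j ->
  (forall m, m < M -> C m < i) ->
  (\sum_(m < M) (i - C m)).*2 < i * i.+1 ->
  i.-1 * i <= (\sum_(m < M) (i.-1 - C m)).*2 ->
  (forall L, \sum_(m < L) (i - C' m) <= \sum_(m < M) (i - C m)) ->
  (forall m, m < M -> m <= C m + (j <= m < j.*2.-1)) ->
  (forall m, m < M -> j.*2 + (j == 2) <= m -> m < C m) ->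
  (forall m K, m <= K -> C' m <= \sum_(1 <= p < K.+1) c p m) ->
  (forall p m, 0 < p -> b p -> c p m <= (p <= m)) ->
  (forall p m, j < p -> ~~ b p -> m.+1 < p.*2 -> c p m = 0) ->
  (forall p m, j < p -> ~~ b p -> m < 3 * j -> m < M -> c p m + m <= (C m).+1) ->
  (forall p, 0 < p <= j -> b p) ->
  ~~ b n.+1 ->
  False.
Proof.
move=> j2 hC E1 E2 D L1 L2 U0 cb c0 cN bj bn.
pose A := \sum_(m < M) C m; pose TM := \sum_(m < M) (m : nat).
have dTM : TM.*2 = M * M.-1 by exact: double_sum_ord.
have sA : \sum_(m < M) (i - C m) + A = M * i.
  rewrite -big_split /= -[M in RHS]card_ord -sum_nat_const; apply: eq_bigr => m _.
  by have := hC m (ltn_ord m); lia.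
have sA1 : \sum_(m < M) (i.-1 - C m) + A = M * i.-1.
  rewrite -big_split /= -[M in RHS]card_ord -sum_nat_const; apply: eq_bigr => m _.
  by have := hC m (ltn_ord m); lia.
(* Comparing [E1] with [E2] leaves 2M < 2i. *)
have Mi : M < i by nia.
pose r := i.-1 - M.
have rE : A.*2 + r * r.+1 <= M * M.-1.
  have ei : i = (M + r).+1 by rewrite /r; lia.
  by move: E2 sA1; rewrite ei /=; nia.
have A_TM : A <= TM by lia.
(* By [L1], [C m] falls short of [m] by at most one, and only at the j - 1 values of [j, 2j - 1). *)
have TM_A : TM <= A + j.-1.
  apply: leq_trans (_ : A + \sum_(m < M) (j <= m < j.*2.-1) <= _).
    by rewrite -big_split /=; apply: leq_sum => m _; exact: L1.
  by rewrite leq_add2l; apply: leq_trans (sum_interval_leq _ _ _) _; lia.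
(* Each [m] covered by [L2] is a surplus of one. As A <= TM, these surpluses cannot outnumber the at
   most j - 1 deficits. *)
have M3j : M <= 3 * j.
  have : TM + (M - (j.*2 + (j == 2))) <= A + j.-1.
    rewrite -sum_leq_ord.
    apply: leq_trans (_ : A + \sum_(m < M) (j <= m < j.*2.-1) <= _).
      rewrite -!big_split /=; apply: leq_sum => m _.
      have := L1 m (ltn_ord m); have := L2 m (ltn_ord m).
      by case: (leqP (j.*2 + (j == 2)) m) => /= h; [move/(_ isT) | move=> _]; lia.
    by rewrite leq_add2l; apply: leq_trans (sum_interval_leq _ _ _) _; lia.
  by case: (eqVneq j 2) => /= ?; lia.
have exP : exists p, (0 < p) && ~~ b p by exists n.+1.
case: (ex_minnP exP) => p1 /andP[p10 bp1] minp1.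
have lt_p1 p : 0 < p -> p < p1 -> b p.
  by move=> p0 lt; apply: contraLR lt => bp; rewrite -leqNgt minp1 // p0.
have jp1 : j < p1 by rewrite ltnNge; apply: contra bp1 => le; rewrite bj // p10.
(* The split is on whether 2 p1 - 1, the least length of a word above the missing s_p1, is at most
   [M]. *)
case: (leqP p1.*2 M.+1) => hp1.
- have AC' : A <= \sum_(m < M) C' m.
    have : M * i <= \sum_(m < M) (i - C' m) + \sum_(m < M) C' m.
      rewrite -big_split /= -[M in M * _]card_ord -sum_nat_const.
      by apply: leq_sum => m _; lia.
    by have := D M; lia.
  have C'G : \sum_(m < M) C' m <= \sum_(1 <= p < M) \sum_(m < M) c p m.
    rewrite exchange_big /=; apply: leq_sum => m _.
    have eM : M.-1.+1 = M by have := ltn_ord m; lia.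
    by have := U0 m M.-1; rewrite eM; apply; have := ltn_ord m; lia.
  (* The word s_p alone would contribute M - p. Replacing it never gains, and at [p1] it loses at
     least TM - A + 1, because j < p1. *)
  have G p : 0 < p -> \sum_(m < M) c p m + (p == p1) * (TM - A).+1 <= M - p.
    move=> p0; case: (boolP (b p)) => bp.
      have -> : (p == p1) = false by apply: contraNF bp1 => /eqP <-.
      by rewrite addn0 -sum_leq_ord; apply: leq_sum => m _; exact: cb.
    have pp1 : p1 <= p by rewrite minp1 // p0.
    case: (leqP p.*2 M.+1) => hp; last first.
      rewrite big1; first by case: eqP; lia.
      by move=> m _; apply: c0 => //; have := ltn_ord m; lia.
    suff : \sum_(m < M) c p m + TM <= A + j.-1 + (M - p.*2.-1) by case: eqP; lia.
    rewrite -sum_leq_ord.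
    apply: leq_trans (_ : A + \sum_(m < M) (j <= m < j.*2.-1) +
        \sum_(m < M) (p.*2.-1 <= m) <= _).
      rewrite -!big_split /=; apply: leq_sum => m _.
      have hm := L1 m (ltn_ord m).
      case: (leqP p.*2.-1 m) => hpm /=; last by rewrite c0 //; lia.
      by have := cN p m _ bp _ (ltn_ord m); have := ltn_ord m; lia.
    rewrite leq_add2r leq_add2l; apply: leq_trans (sum_interval_leq _ _ _) _; lia.
  have SG : \sum_(1 <= p < M) \sum_(m < M) c p m + (TM - A).+1 <= \sum_(1 <= p < M) (M - p).
    apply: leq_trans (_ : \sum_(1 <= p < M) (\sum_(m < M) c p m + (p == p1) * (TM - A).+1) <= _).
      rewrite big_split /= leq_add2l (bigD1_seq p1) ?iota_uniq //=.
        by rewrite eqxx mul1n leq_addr.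
      by rewrite mem_index_iota; lia.
    by rewrite big_nat [leqRHS]big_nat; apply: leq_sum => p /andP[p0 _]; exact: G.
  have eS : \sum_(1 <= p < M) (M - p) = TM.
    exact: sum_nat_rev.
  lia.
(* In this range a missing s_p has no word above it yet, so each p <= m contributes at most one and
   [p1] contributes nothing. *)
- have C'le m : m.+1 < p1.*2 -> C' m + (p1 <= m) <= m.
    move=> hm; apply: leq_trans (_ : \sum_(1 <= p < m.+1) (c p m + (p == p1)) <= _).
      rewrite big_split /= leq_add ?U0 //; case: (leqP p1 m) => //= h.
      rewrite (bigD1_seq p1) ?iota_uniq //=; first by rewrite eqxx leq_addr.
      by rewrite mem_index_iota; lia.
    apply: leq_trans (_ : \sum_(1 <= p < m.+1) 1 <= m); last by rewrite sum_nat_const_nat; lia.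
    rewrite big_nat [leqRHS]big_nat; apply: leq_sum => p /andP[p0 pm].
    case: (boolP (b p)) => bp.
      have -> : (p == p1) = false by apply: contraNF bp1 => /eqP <-.
      by rewrite addn0 (leq_trans (cb _ _ _ bp)) ?leq_b1.
    have pp1 : p1 <= p by rewrite minp1 // p0.
    by rewrite c0 ?leq_b1 //; lia.
  (* For i < 2 p1, the bound [C'le] up to [i] already forces a prefix sum of at least i(i+1)/2. *)
  case: (ltnP i p1.*2) => hi.
    have : i * i <= \sum_(m < i) (i - C' m) + \sum_(m < i) m.
      rewrite -big_split /= -[i in i * _]card_ord -sum_nat_const.
      apply: leq_sum => m _; have := C'le m; have := ltn_ord m; lia.
    have := D i; have := double_sum_ord_add i; rewrite mulnS in E1.
    lia.
  (* Here L > M, hence s <= r and s(s+1)/2 <= j - 1. The loss L - p1 = p1 - 1 >= j caused by the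
     missing s_p1 is larger. *)
  pose L := p1.*2.-1.
  have : L * i + (L - p1) <= \sum_(m < L) (i - C' m) + \sum_(m < L) m.
    rewrite -sum_leq_ord -[L in L * _]card_ord -sum_nat_const -!big_split /=.
    apply: leq_sum => m _; have := C'le m; have := ltn_ord m; rewrite /L; lia.
  have := D L; have := double_sum_ord_add L.
  have [s sE] : exists s, i = L + s by exists (i - L); lia.
  have sr : s * s.+1 <= r * r.+1 by apply: leq_mul; rewrite /r /L in sE *; lia.
  have rj : r * r.+1 <= j.-1.*2 by lia.
  have lp : j.-1 < L - p1 by rewrite /L; lia.
  move: E1 sr; rewrite mulnS sE !(mulnDl, mulnDr, mulnS) (mulnC s L).
  clearbody L; lia.
Qed.

(** * The words s_p and the palindromes above them *)

Lemma s_ge2 p : 2 <= p -> s_ p = true :: rcons (nseq (p - 2) false) true.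
Proof. by move=> p2; rewrite /s_ leqNgt p2. Qed.

Lemma size_s p : 0 < p -> size (s_ p) = p.
Proof.
rewrite /s_; case: (leqP p 1) => h p0 /=; first by lia.
by rewrite size_rcons size_nseq; lia.
Qed.

Lemma leq_size_s p (w : word) : 0 < p -> prefix (s_ p) w -> p <= size w.
Proof. by move=> p0 /size_prefix; rewrite size_s. Qed.

Lemma palindrome_s p : palindrome (s_ p).
Proof.
rewrite /palindrome /s_; case: ifP => //= _.
by rewrite rev_cons rev_rcons rev_nseq rcons_cons.
Qed.

Lemma nth_s p k : 2 <= p -> nth false (s_ p) k = (k == 0) || (k == p.-1).
Proof.
move=> p2; rewrite s_ge2 //; case: k => [|k] //=.
rewrite nth_rcons size_nseq nth_nseq if_same.
by case: ltnP => h; case: eqP => h' //; lia.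
Qed.

Lemma prefix_nth (u w : word) k : prefix u w -> k < size u -> nth false w k = nth false u k.
Proof. by move=> /prefixP[v ->] lt; rewrite nth_cat lt. Qed.

Lemma prefix_leq_size (u v w : word) :
  prefix u w -> prefix v w -> size u <= size v -> prefix u v.
Proof.
rewrite !prefixE => /eqP hu /eqP hv le; apply/eqP.
by rewrite -hv -{2}hu take_takel.
Qed.

(** The first letter separates s_1 from the others; otherwise [p] is fixed by the position of the
    second 1 of [w]. *)
Lemma prefix_s_inj p q w : 0 < p -> 0 < q ->
  prefix (s_ p) w -> prefix (s_ q) w -> p = q.
Proof.
wlog le : p q / p <= q.
  move=> th p0 q0 hp hq; case: (leqP p q) => h; first exact: th.
  by apply/esym/th => //; apply: ltnW.
move=> p0 q0 hp hq; case: (leqP 2 p) => p2.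
  have := nth_s p.-1 p2; rewrite -(prefix_nth hp) ?size_s //; last by lia.
  by rewrite (prefix_nth hq) ?size_s ?nth_s; lia.
have := prefix_nth hp (k := 0); have := prefix_nth hq (k := 0).
rewrite !size_s // => -> // /(_ p0).
case: (leqP 2 q) => q2; last by lia.
have -> : p = 1 by lia.
by rewrite nth_s.
Qed.

Lemma palindrome_nth w k : palindrome w -> k < size w ->
  nth false w (size w - k.+1) = nth false w k.
Proof. by move=> /eqP pw lt; rewrite -nth_rev // pw. Qed.

Lemma s_suffix p w k : 2 <= p -> palindrome w -> prefix (s_ p) w -> k < p ->
  nth false w (size w - p + k) = (k == 0) || (k == p.-1).
Proof.
move=> p2 pw hp lt; have le : p <= size w by apply: leq_size_s hp; lia.
have -> : size w - p + k = size w - (p - k.+1).+1 by lia.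
rewrite palindrome_nth //; last by lia.
by rewrite (prefix_nth hp) ?size_s ?nth_s; lia.
Qed.

(** In a shorter [w] the final copy of s_p would start on one of the inner zeros of the initial
    copy. *)
Lemma size_s_prefix p w : 2 <= p -> palindrome w -> proper_prefix (s_ p) w ->
  p.*2 <= (size w).+1.
Proof.
move=> p2 pw /andP[hp]; rewrite size_s; last by lia.
move=> lt; rewrite leqNgt; apply/negP => h.
have := s_suffix (k := 0) p2 pw hp; rewrite addn0 => /(_ ltac:(lia)).
by rewrite (prefix_nth hp) ?size_s ?nth_s; lia.
Qed.

(* Two occurrences of [s_ j] start at least [j - 1] apart, and a longer border
   would make three of them. *)
Lemma in_N_short j w : 2 <= j -> palindrome w -> proper_prefix (s_ j) w ->
  size w <= 3 * j - 3 -> in_N (s_ j) w.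
Proof.
move=> j2 pw hw sw; have j0 : 0 < j by lia.
split=> //; split; first exact: palindrome_s.
split=> // u pu /andP[uw lt]; rewrite size_s // leqNgt; apply/negP => ju.
case/andP: (hw) => jw _.
have pju : prefix (s_ j) u by apply: prefix_leq_size jw uw _; rewrite size_s // ltnW.
have su := @size_s_prefix j u j2 pu; rewrite /proper_prefix pju size_s // in su.
have {}su := su ju.
(* The size bounds give 1 <= d <= j - 2, so the copy of s_j ending [w] would start on a zero of the
   copy ending [u]. *)
pose d := size w - size u.
have := s_suffix (k := d) j2 pu pju; have := s_suffix (k := 0) j2 pw jw.
rewrite -(prefix_nth uw); last by rewrite /d; lia.
have -> : size u - j + d = size w - j + 0 by rewrite /d; lia.
by move=> -> //; rewrite /d; lia.
Qed.

(** The shortest palindromic prefix of [w] longer than s_j is a child of s_j. *)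
Lemma in_N_prefix j w : palindrome w -> proper_prefix (s_ j) w ->
  exists2 t, in_N (s_ j) t & prefix t w.
Proof.
move=> pw /andP[hj lt].
pose P k := palindrome (take k w) && (size (s_ j) < k).
have exP : exists k, P k by exists (size w); rewrite /P take_size pw.
case: (ex_minnP exP) => k /andP[pk ltk] mk; have kw : k <= size w.
  by apply: mk; rewrite /P take_size pw.
exists (take k w); last exact: prefix_take.
have sk : size (take k w) = k by rewrite size_takel.
split=> //; split; first exact: palindrome_s.
have jk : prefix (s_ j) (take k w).
  by apply: prefix_leq_size hj (prefix_take _ _) _; rewrite sk ltnW.
split; first by rewrite /proper_prefix jk sk.
move=> u pu /andP[uk]; rewrite sk => ltu; rewrite leqNgt; apply/negP => h.
have := mk (size u); rewrite /P h andbT.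
have /eqP <- : u == take (size u) w.
  by rewrite eq_sym -prefixE (prefix_trans uk) // prefix_take.
by rewrite pu => /(_ isT); lia.
Qed.

(** A palindrome starting with 1, other than 1 itself, also ends with 1; cutting it after its second
    1 gives s_p. *)
Lemma exists_s_prefix w : palindrome w -> w != [::] -> w != [:: true] ->
  exists2 p, 0 < p <= size w & prefix (s_ p) w.
Proof.
case: w => [|[] w] //= pw _ w1; last by exists 1 => //; rewrite /s_ /= prefix0s.
have w_t : true \in w.
  case/lastP: w pw w1 => [|w b] // + _.
  by rewrite /palindrome rev_cons rev_rcons rcons_cons => /eqP[-> _]; rewrite mem_rcons mem_head.
have lt := w_t; rewrite -index_mem in lt.
exists (index true w).+2; first by rewrite ltnS.
rewrite s_ge2 // subSS subSS subn0 /=.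
suff -> : rcons (nseq (index true w) false) true = take (index true w).+1 w by exact: prefix_take.
rewrite (take_nth false lt) nth_index //; congr rcons.
apply: (@eq_from_nth _ false); first by rewrite size_nseq size_takel // ltnW.
move=> i; rewrite size_nseq => li; rewrite nth_nseq li nth_take //.
by have /= := before_find false li; case: nth.
Qed.

(** * Codes, and the number of their words above each s_p *)

Lemma in_Sn_antichain n S u w : in_Sn n S -> u \in S -> w \in S -> prefix u w -> u = w.
Proof.
case/and4P => /andP[/andP[uS _] /forallP aS] _ _ _ uinS winS uw.
have iu : index u S < size S by rewrite index_mem.
have iw : index w S < size S by rewrite index_mem.
have /forallP/(_ (Ordinal iw)) := aS (Ordinal iu).
rewrite /= !nth_index // /proper_prefix uw /= -leqNgt => le.
by apply/eqP; move: uw; rewrite prefixE take_oversize // eq_sym.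
Qed.

Lemma in_Sn_palindrome n S w : in_Sn n S -> w \in S -> palindrome w.
Proof. by case/and4P => /andP[/andP[_ /allP h] _] _ _ _ /h. Qed.

Lemma in_Sn_uniq n S : in_Sn n S -> uniq S.
Proof. by case/and4P => /andP[/andP[]]. Qed.

Lemma in_Sn_size n S : in_Sn n S -> size S = n.
Proof. by case/and4P => _ /eqP. Qed.

Lemma in_Sn_leq n S w : in_Sn n S -> w \in S -> size w <= n.
Proof. by case/and4P => _ _ _ /allP h /h. Qed.

Lemma in_Sn_cnt n S m : in_Sn n S -> n <= m -> cnt S m = n.
Proof. by move=> hS le; rewrite -(in_Sn_size hS); apply: cnt_all le; case/and4P: hS. Qed.

Lemma in_Sn_s_prefix n S w : 2 <= n -> in_Sn n S -> w \in S ->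
  exists2 p, 0 < p <= size w & prefix (s_ p) w.
Proof.
move=> n2 hS wS; apply: exists_s_prefix; first exact: in_Sn_palindrome hS wS.
  (* The empty word is a prefix of every word, so it would be alone in the code, against n >= 2. *)
  apply: contraTneq n2 => w0; subst w; rewrite -leqNgt -(in_Sn_size hS).
  have -> : 1 = size [:: ([::] : word)] by [].
  apply: uniq_leq_size; first exact: in_Sn_uniq hS.
  by move=> u uS; rewrite inE; apply/eqP/esym/(in_Sn_antichain hS) => //; apply: prefix0s.
by case/and4P: hS => _ _ t _; apply: contraNneq t => <-.
Qed.

Lemma proper_prefix_notin (S : seq word) (u w : word) :
  u \notin S -> w \in S -> prefix u w -> proper_prefix u w.
Proof.
move=> uS wS uw; rewrite /proper_prefix uw ltnNge; apply: contra uS => le.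
by move: uw; rewrite prefixE take_oversize // => /eqP <-.
Qed.

Definition scnt (S : seq word) (p m : nat) : nat :=
  count (fun w => prefix (s_ p) w && (size w <= m)) S.

Lemma cnt_leq_sum_scnt n S m M : 2 <= n -> in_Sn n S -> m <= M ->
  cnt S m <= \sum_(1 <= p < M.+1) scnt S p m.
Proof.
move=> n2 hS mM; rewrite /cnt -sum1_count big_mkcond /=.
under [leqRHS]eq_bigr => p _ do rewrite /scnt -sum1_count big_mkcond /=.
rewrite exchange_big /= big_seq [leqRHS]big_seq; apply: leq_sum => w wS.
case: ifP => // wm; have [p /andP[p0 pw] pre] := in_Sn_s_prefix n2 hS wS.
rewrite (bigD1_seq p) ?iota_uniq //=; last by rewrite mem_index_iota p0 ltnS (leq_trans pw) // (leq_trans wm).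
by rewrite pre.
Qed.

(** In a prefix-free code s_p excludes every other word above it. *)
Lemma scnt_leq1 n S p m : in_Sn n S -> 0 < p -> s_ p \in S -> scnt S p m <= (p <= m).
Proof.
move=> hS p0 pS.
case: (leqP p m) => pm.
  apply: (@leq_trans (count_mem (s_ p) S)); last first.
    by rewrite count_uniq_mem ?leq_b1 // (in_Sn_uniq hS).
  rewrite /scnt -!size_filter; apply: uniq_leq_size; first exact/filter_uniq/in_Sn_uniq/hS.
  move=> w; rewrite !mem_filter => /andP[/andP[pw _] wS]; rewrite wS andbT /=.
  exact/eqP/esym/(in_Sn_antichain hS).
rewrite leqNgt -has_count; apply/hasPn => w wS; apply/negP => /andP[pw].
by have /= := leq_size_s p0 pw; lia.
Qed.

Lemma scnt_eq0 n S p m : in_Sn n S -> 2 <= p -> s_ p \notin S -> m.+1 < p.*2 ->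
  scnt S p m = 0.
Proof.
move=> hS p2 pS lt; apply/eqP; rewrite -leqn0 leqNgt -has_count; apply/hasPn => w wS.
apply/negP => /andP[pw wm].
have /= := size_s_prefix p2 (in_Sn_palindrome hS wS) (proper_prefix_notin pS wS pw).
by move: wm => /=; lia.
Qed.

(** * Mapping words above s_p to children of s_j *)

Lemma palindrome_split (y w : word) : palindrome w -> prefix y w -> (size y).*2 <= size w ->
  exists2 v, w = y ++ v ++ rev y & palindrome v.
Proof.
move=> pw yw le; case/prefixP: yw => z ew.
have sz : size w = size y + size z by rewrite ew size_cat.
pose v := take (size z - size y) z.
have ez : z = v ++ rev y.
  rewrite -(cat_take_drop (size z - size y) z); congr (_ ++ _).
  move/eqP: pw; rewrite {1}ew rev_cat => e.
  have := congr1 (drop (size z)) e; rewrite drop_cat size_rev ltnn subnn drop0.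
  move=> ->; rewrite ew drop_cat; case: ltnP => h; first by size_lia.
  by congr drop; size_lia.
exists v; first by rewrite -ez.
move: pw; rewrite /palindrome ew ez !rev_cat revK -catA.
by rewrite eqseq_cat // eqxx /= eqseq_cat ?size_rev // eqxx andbT.
Qed.

(* For [d = p - j + 1] this sends s_p u s_p to s_j u s_j, and likewise when the two
   copies of s_p share a letter. *)
Definition strip (d : nat) (w : word) : word :=
  true :: rcons (take (size w - d.*2) (drop d w)) true.

Lemma strip_cat (y v : word) :
  strip (size y) (y ++ v ++ rev y) = true :: rcons v true.
Proof.
rewrite /strip drop_size_cat // !size_cat size_rev take_size_cat //; lia.
Qed.

(** Write s_p as [y] = 1 0^(p-j) followed by 0^(j-2) 1. Since |w| >= 2p - 1, both ends of [w] carry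
    [y] without overlap, and the middle is long enough to start with 0^(j-2) 1. *)
Lemma stripE j p w : 2 <= j -> j < p -> palindrome w -> proper_prefix (s_ p) w ->
  exists v, let y := true :: nseq (p - j) false in
  [/\ w = y ++ v ++ rev y, palindrome v, prefix (rcons (nseq (j - 2) false) true) v
    & strip (p - j).+1 w = true :: rcons v true].
Proof.
move=> j2 jp pw hw; have le := @size_s_prefix p w ltac:(lia) pw hw.
case/andP: hw => hp _.
have sE : s_ p = (true :: nseq (p - j) false) ++ rcons (nseq (j - 2) false) true.
  rewrite s_ge2; last by lia.
  by rewrite /= -rcons_cat cat_nseq /ncons -iterD -/(ncons _ _ _) -/(nseq _ _); congr (_ :: rcons (nseq _ _) _); lia.
have yw : prefix (true :: nseq (p - j) false) w.
  by apply: prefix_trans hp; rewrite sE prefix_prefix.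
have sy : size (true :: nseq (p - j) false) = (p - j).+1 by rewrite /= size_nseq.
have [|v ew pv] := palindrome_split pw yw; first by rewrite sy; lia.
exists v; split => //; last by rewrite ew -sy strip_cat.
have sw := congr1 size ew; rewrite !size_cat size_rev sy in sw.
move: hp; rewrite {1}ew sE prefix_catr // => /andP[_ h].
apply: (prefix_leq_size h); first exact: prefix_prefix.
rewrite size_rcons size_nseq; size_lia.
Qed.

(** Stripping shortens a word by 2(p - j) >= 2, so length at most 3j - 1 becomes at most 3j - 3, the
    bound of [in_N_short]. It is injective because the removed [y] depends only on [p] and [j]. *)
Lemma scnt_embed n S j p m : in_Sn n S -> 2 <= j -> j < p -> s_ p \notin S -> m < 3 * j ->
  exists X : seq word, [/\ uniq X, size X = scnt S p m,
    (forall x, x \in X -> in_N (s_ j) x) & (forall x, x \in X -> size x <= m)].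
Proof.
move=> hS j2 jp pS mj.
pose F := [seq w <- S | prefix (s_ p) w && (size w <= m)].
have FP w : w \in F -> [/\ palindrome w, proper_prefix (s_ p) w & size w <= m].
  rewrite mem_filter => /andP[/andP[pw wm] wS]; split => //; first exact: in_Sn_palindrome hS wS.
  exact: proper_prefix_notin pS wS pw.
exists (map (strip (p - j).+1) F); split.
- rewrite map_inj_in_uniq; first exact/filter_uniq/in_Sn_uniq/hS.
  move=> u w /FP[pu hu _] /FP[pw hw _].
  have [a [-> _ _ ->]] := stripE j2 jp pu hu.
  have [b [-> _ _ ->]] := stripE j2 jp pw hw.
  by move=> [] /rcons_inj[->].
- by rewrite size_map size_filter.
- move=> x /mapP[w /FP[pw hw wm] ->].
  have [v [ew pv zv ->]] := stripE j2 jp pw hw.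
  have sw := congr1 size ew; rewrite !size_cat size_rev /= size_nseq in sw.
  apply: in_N_short => //.
  + by move: pv; rewrite /palindrome rev_cons rev_rcons rcons_cons => /eqP ->.
  + have := size_prefix zv; rewrite size_rcons size_nseq /= => sv.
    rewrite /proper_prefix size_s /= ?size_rcons; last by lia.
    apply/andP; split; last by lia.
    case/prefixP: zv => t ->; rewrite s_ge2 //; apply/prefixP; exists (rcons t true).
    by rewrite rcons_cat.
  + by rewrite /= size_rcons; size_lia.
- move=> x /mapP[w /FP[pw hw wm] ->].
  have [v [ew _ _ ->]] := stripE j2 jp pw hw.
  have sw := congr1 size ew; rewrite !size_cat size_rev /= size_nseq in sw.
  by rewrite /= size_rcons; size_lia.
Qed.

(** * Greedy choice from the expansion of s_j *)

(** The candidate set [T] of [R_implies]. *)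
Definition expansion (n j : nat) (w : word) : Prop :=
  (w \in R_ n \/ in_Nn n (s_ j) w) /\ w <> s_ j.

Lemma expansion_s n j p : 0 < p <= n -> p <> j -> 0 < j -> expansion n j (s_ p).
Proof.
move=> pn pj j0; split; last by move=> /(congr1 size); rewrite !size_s //; lia.
by left; apply/mapP; exists p; rewrite // mem_iota; lia.
Qed.

Lemma expansion_N n j w : in_N (s_ j) w -> size w <= n -> expansion n j w.
Proof.
move=> hw le; split; first by right.
case: hw => _ [_ [/andP[_ +] _]] => + e; by rewrite e ltnn.
Qed.

(** While fewer than [n] words are used, [S] holds every candidate of length at most [m]: all s_p
    with p <= m and p <> j, and the children in [X]. *)
Lemma leq_expansion_cnt n j S X m : 0 < j ->
  (forall u, expansion n j u -> cnt S (size u) < n -> u \in S) ->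
  m <= n -> cnt S m < n -> uniq X -> (forall x, x \in X -> in_N (s_ j) x) ->
  (forall x, x \in X -> size x <= m) ->
  m + size X <= cnt S m + (j <= m).
Proof.
move=> j0 hS mn cn uX NX sX.
pose Y := [seq s_ p | p <- filter (predC1 j) (iota 1 m)] ++ X.
have mS u : expansion n j u -> size u <= m -> u \in [seq w <- S | size w <= m].
  move=> eu le; rewrite mem_filter le; apply: hS eu _.
  by apply: leq_ltn_trans cn; apply: leq_cnt.
have uY : uniq Y.
  rewrite cat_uniq uX andbT map_inj_in_uniq ?filter_uniq ?iota_uniq //=.
    apply/hasPn => x /NX [_ [_ [/andP[jx ltjx] _]]]; apply/mapP => -[p].
    rewrite mem_filter mem_iota /= => /andP[pj hp] ex; subst x.
    by case/eqP: pj; apply/esym/(prefix_s_inj _ _ jx); rewrite ?prefix_refl //; lia.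
  move=> p q; rewrite !mem_filter !mem_iota /= => /andP[_ hp] /andP[_ hq].
  by move/(congr1 size); rewrite !size_s //; lia.
have : size Y <= cnt S m.
  rewrite /cnt -size_filter; apply: uniq_leq_size => // w; rewrite mem_cat => /orP[|wX].
    case/mapP => p; rewrite mem_filter mem_iota /= => /andP[pj hp] ->.
    apply: mS; last by rewrite size_s; lia.
    by apply: expansion_s => //; [lia | exact/eqP].
  by apply: mS (sX _ wX); apply: expansion_N (NX _ wX) _; apply: leq_trans (sX _ wX) _.
rewrite size_cat size_map.
have : count_mem j (iota 1 m) + count (predC1 j) (iota 1 m) = m.
  by rewrite -[RHS](size_iota 1 m) -(count_predC (pred1 j)).
rewrite size_filter count_uniq_mem ?iota_uniq // mem_iota add1n ltnS j0 /=.
by case: (leqP j m) => /=; size_lia.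
Qed.

(** As long as s_j is not met, the short words of [S'] all lie in [S]; so [S'] can get ahead only by
    using s_j, and before length [j] both codes agree. *)
Lemma s_mem_of_cnt n j S S' m0 : 2 <= n -> 0 < j <= n -> in_Sn n S' -> uniq S ->
  (forall w, w \in S -> expansion n j w) ->
  (forall u, expansion n j u -> cnt S (size u) < n -> u \in S) ->
  (forall m, m < m0 -> cnt S m = cnt S' m) -> cnt S m0 < cnt S' m0 ->
  forall p, 0 < p <= j -> s_ p \in S'.
Proof.
move=> n2 /andP[j0 jn] hS' uS eS hS eqC ltC.
have cn m : m <= m0 -> cnt S m < n.
  move=> le; apply: leq_ltn_trans (leq_cnt S le) (leq_trans ltC _).
  by rewrite -(in_Sn_size hS') cnt_size.
(* Below every word of [S'] other than s_j lies a candidate: some s_p with p <> j, or a child of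
   s_j. *)
have anc w : w \in S' -> w <> s_ j -> exists2 t, expansion n j t & prefix t w.
  move=> wS' wj; have [p /andP[p0 pw] pre] := in_Sn_s_prefix n2 hS' wS'.
  have wn := in_Sn_leq hS' wS'.
  case: (eqVneq p j) => [epj | pj]; last first.
    exists (s_ p) => //; apply: expansion_s => //; last exact/eqP.
    by rewrite p0 (leq_trans pw).
  subst p; have hjw : proper_prefix (s_ j) w.
    rewrite /proper_prefix pre size_s // ltn_neqAle pw andbT; apply/eqP => ej.
    by apply: wj; move: pre; rewrite prefixE size_s // ej take_size => /eqP.
  have [t ht tw] := in_N_prefix (in_Sn_palindrome hS' wS') hjw.
  by exists t => //; apply: expansion_N => //; apply: leq_trans (size_prefix tw) wn.
have sub k : k <= m0 -> (forall w, w \in S' -> size w <= k -> w <> s_ j) ->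
    {subset [seq w <- S' | size w <= k] <= [seq w <- S | size w <= k]}.
  elim/ltn_ind: k => k IH km hk w; rewrite !mem_filter => /andP[wk wS'].
  rewrite wk /=; have [t et tw] := anc w wS' (hk w wS' wk).
  have tk := size_prefix tw.
  have tm : size t <= m0 by apply: leq_trans tk (leq_trans wk km).
  have tS : t \in S by apply: hS et (cn _ tm).
  case: (eqVneq t w) => [<- // | tw'].
  have ltw : size t < size w.
    rewrite ltn_neqAle tk andbT; apply: contra tw' => /eqP e.
    by move: tw; rewrite prefixE e take_size eq_sym.
  have ltk : size t < k by apply: leq_trans wk.
  (* Up to length |t| the inclusion holds by induction and the counts agree, so the two sets are
     equal; then [t] is in [S'] below [w], against prefix-freeness. *)
  have st := IH _ ltk tm (fun w wS' le => hk w wS' (leq_trans le (ltnW ltk))).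
  have uF : uniq [seq w <- S' | size w <= size t] by apply/filter_uniq/in_Sn_uniq/hS'.
  have szF : size [seq w <- S | size w <= size t] <= size [seq w <- S' | size w <= size t].
    by rewrite !size_filter -/(cnt S _) -/(cnt S' _) eqC // (leq_trans ltk).
  have [_ eqm] := uniq_min_size uF st szF.
  have : t \in [seq w <- S | size w <= size t] by rewrite mem_filter leqnn.
  rewrite -eqm mem_filter => /andP[_ tS'].
  by case/eqP: tw'; apply: in_Sn_antichain hS' tS' wS' tw.
have absurd : ~ (forall w, w \in S' -> size w <= m0 -> w <> s_ j).
  move=> h; have := uniq_leq_size (filter_uniq _ (in_Sn_uniq hS')) (sub m0 (leqnn _) h).
  by rewrite !size_filter leqNgt => /negP; apply.
have [jS' jm0] : s_ j \in S' /\ j <= m0.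
  case: (boolP ((s_ j \in S') && (j <= m0))) => [/andP[] // | /negP h].
  case: absurd => w wS' wm ew; apply: h; rewrite -ew wS' /=.
  by rewrite -(size_s j0) -ew.
move=> p /andP[p0]; rewrite leq_eqVlt => /orP[/eqP -> // | pj].
have pm0 := leq_trans pj jm0.
have st : {subset [seq w <- S' | size w <= p] <= [seq w <- S | size w <= p]}.
  apply: sub (ltnW pm0) _ => w _ wp ew; move: wp; rewrite ew size_s //; lia.
have uF : uniq [seq w <- S' | size w <= p] by apply/filter_uniq/in_Sn_uniq/hS'.
have szF : size [seq w <- S | size w <= p] <= size [seq w <- S' | size w <= p].
  by rewrite !size_filter -/(cnt S _) -/(cnt S' _) eqC.
have [_ eqm] := uniq_min_size uF st szF.
have : s_ p \in [seq w <- S | size w <= p].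
  rewrite mem_filter size_s // leqnn; apply: hS; first by apply: expansion_s; lia.
  by rewrite size_s // cn // ltnW.
by rewrite -eqm mem_filter => /andP[].
Qed.

(** * Short children of s_j *)

(** Testing only the prefixes of [w] lets concrete instances follow by evaluation. *)
Lemma in_N_compute (s w : word) : palindrome w -> palindrome s -> proper_prefix s w ->
  all (fun k => palindrome (take k w) ==> (k <= size s)) (iota 0 (size w)) -> in_N s w.
Proof.
move=> pw ps sw /allP h; do 3!split => //; move=> u pu /andP[].
rewrite prefixE => /eqP uw lt.
by have := h (size u); rewrite mem_iota lt uw pu => /(_ isT).
Qed.

(** The witness is two copies of s_j sharing a 1. *)
Lemma in_N_overlap j : 2 <= j ->
  exists2 w, in_N (s_ j) w & size w = j.*2.-1.
Proof.
move=> j2; pose a := nseq (j - 2) false.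
exists (true :: rcons (a ++ true :: a) true); last first.
  by rewrite /= size_rcons size_cat /= size_nseq; lia.
apply: in_N_short => //.
- by rewrite /palindrome rev_cons rev_rcons rev_cat rev_cons !rev_nseq cat_rcons rcons_cons.
- rewrite /proper_prefix size_s /= ?size_rcons ?size_cat /= ?size_nseq; last by lia.
  apply/andP; split; last by lia.
  rewrite s_ge2 //; apply/prefixP; exists (rcons a true).
  by rewrite rcons_cat /= cat_rcons.
- by rewrite /= size_rcons size_cat /= size_nseq; lia.
Qed.

Lemma in_N_square j : 2 < j ->
  exists2 w, in_N (s_ j) w & size w = j.*2.
Proof.
move=> j3; have ss : size (s_ j ++ s_ j) = j.*2 by rewrite size_cat !size_s; lia.
exists (s_ j ++ s_ j) => //; apply: in_N_short => //; first by lia.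
- by rewrite /palindrome rev_cat (eqP (palindrome_s j)).
- by rewrite /proper_prefix prefix_prefix ss size_s; lia.
- by rewrite ss; lia.
Qed.

(** For j = 2 the square 1111 is not a child of 11, as 111 lies between; 11011 replaces it, whence
    the extra one in the bound. *)
Lemma in_N_two j m : 2 <= j -> j.*2 + (j == 2) <= m ->
  exists u v, [/\ in_N (s_ j) u, in_N (s_ j) v, size u < size v & size v <= m].
Proof.
move=> j2 jm; have [u Nu su] := in_N_overlap j2.
case: (eqVneq j 2) jm => [ej|jn2] jm.
  exists u, [:: true; true; false; true; true]; subst j; split; rewrite ?su //.
  exact: in_N_compute.
have [v Nv sv] : exists2 w, in_N (s_ j) w & size w = j.*2 by apply: in_N_square; lia.
by exists u, v; split; rewrite ?su ?sv //; lia.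
Qed.

(** * The cases j = 1 and j >= 2, and the conclusion *)

(** Up to length 4 the palindromes above 11 consist of ones only, so they form a chain. *)
Lemma scnt2_leq1 n S m : in_Sn n S -> m <= 4 -> scnt S 2 m <= 1.
Proof.
move=> hS m4; rewrite /scnt -size_filter.
set F := filter _ _; have uF : uniq F by apply/filter_uniq/in_Sn_uniq/hS.
have FP w : w \in F -> w \in S /\ w = nseq (size w) true.
  rewrite mem_filter => /andP[/andP[pw wm] wS]; split => //.
  have := in_Sn_palindrome hS wS; have := leq_trans wm m4; case/prefixP: pw => z ->.
  by case: z => [|[] [|[] [|? ?]]].
have eqF u w : u \in F -> w \in F -> u = w.
  wlog le : u w / size u <= size w.
    move=> th uF' wF; case: (leqP (size u) (size w)) => h; first exact: th.
    by apply/esym/th => //; apply: ltnW.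
  move=> /FP[uS eu] /FP[wS ew]; apply: in_Sn_antichain hS uS wS _.
  apply/prefixP; exists (nseq (size w - size u) true).
  by rewrite {1}ew {1}eu cat_nseq /ncons -iterD -/(ncons _ _ _) -/(nseq _ _) subnKC.
case: F uF eqF {FP} => [|u [|v F]] //= /andP[uv _] /(_ u v).
by rewrite !inE !eqxx !orbT => /(_ isT isT) e; rewrite e mem_head in uv.
Qed.

Lemma not_dominates_expand0 n S S' : 5 <= n -> in_Sn n S -> in_Sn n S' ->
  (forall u, expansion n 1 u -> cnt S (size u) < n -> u \in S) ->
  s_ 1 \in S' -> ~ dominates n (lengths S') (lengths S).
Proof.
move=> n5 hS hS' eS s1 dom.
have C2 : 1 < cnt S 2.
  case: (ltnP (cnt S 2) n) => h; last by lia.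
  have := @leq_expansion_cnt n 1 S [:: [:: false; false]] 2 isT eS ltac:(lia) h isT.
  move=> /(_ _ _)/= H; suff: 2 + 1 <= cnt S 2 + 1 by lia.
  by apply: H => x; rewrite inE => /eqP ->; [exact: in_N_compute|].
have C3 : 3 < cnt S 3.
  case: (ltnP (cnt S 3) n) => h; last by lia.
  have := @leq_expansion_cnt n 1 S [:: [:: false; false]; [:: false; true; false]] 3
    isT eS ltac:(lia) h isT.
  move=> /(_ _ _)/= H; suff: 3 + 2 <= cnt S 3 + 1 by lia.
  by apply: H => x; rewrite !inE => /orP[] /eqP ->; try exact: in_N_compute.
have C4 : 4 < cnt S 4.
  case: (ltnP (cnt S 4) n) => h; last by lia.
  have := @leq_expansion_cnt n 1 S [:: [:: false; false]; [:: false; true; false]] 4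
    isT eS ltac:(lia) h isT.
  move=> /(_ _ _)/= H; suff: 4 + 2 <= cnt S 4 + 1 by lia.
  by apply: H => x; rewrite !inE => /orP[] /eqP ->; try exact: in_N_compute.
have C' m : m <= 4 -> cnt S' m <= m.
  move=> m4; apply: leq_trans (cnt_leq_sum_scnt _ hS' (leqnn m)) _; first by lia.
  apply: leq_trans (_ : \sum_(1 <= p < m.+1) 1 <= m); last by rewrite sum_nat_const_nat; lia.
  rewrite big_nat [leqRHS]big_nat; apply: leq_sum => p /andP[p0 pm].
  case: (boolP (s_ p \in S')) => ps.
    by apply: leq_trans (scnt_leq1 _ hS' p0 ps) (leq_b1 _).
  case: (eqVneq p 2) => [->|p2]; first exact: scnt2_leq1 hS' m4.
  case: (eqVneq p 1) => [p1|p1]; first by rewrite p1 s1 in ps.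
  by rewrite (scnt_eq0 hS' _ ps) //; lia.
(* The five smallest lengths sum to at most 2+2+3+3+4 = 14 in [S], but to at least 1+2+3+4+5 = 15 in
   [S']. *)
have := dom 5 ltac:(lia).
rewrite (@prefix_sum_eq S 5 4) ?(in_Sn_size hS) //.
have := @leq_prefix_sum S' 5 5; rewrite (in_Sn_size hS') => /(_ n5).
rewrite !big_ord_recr !big_ord0 /=.
have := C' 0 isT; have := C' 1 isT; have := C' 2 isT; have := C' 3 isT; have := C' 4 isT.
lia.
Qed.

Lemma not_dominates_expand n j S S' : 5 <= n -> 2 <= j <= n -> in_Sn n S -> in_Sn n S' ->
  (forall u, expansion n j u -> cnt S (size u) < n -> u \in S) ->
  sumn (lengths S) < n * (n + 1) %/ 2 ->
  (forall p, 0 < p <= j -> s_ p \in S') -> ~ dominates n (lengths S') (lengths S).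
Proof.
move=> n5 /andP[j2 jn] hS hS' eS sumS sS' dom.
have szS := in_Sn_size hS; have szS' := in_Sn_size hS'.
pose P i := (sumn (take i (lengths S))).*2 < i * i.+1.
have exP : exists i, P i.
  by exists n; rewrite /P take_oversize ?size_sort ?size_map ?szS //; move: sumS; rewrite addn1; lia.
case: (ex_minnP exP) => i Pi mini.
have i_n : i <= n.
  by apply: mini; rewrite /P take_oversize ?size_sort ?size_map ?szS //; move: sumS; rewrite addn1; lia.
have i0 : 0 < i by move: Pi; rewrite /P; case: (i).
have exM : exists m, i <= cnt S m by exists n; rewrite (in_Sn_cnt hS).
(* This [M] is the [i]-th smallest length of [S]. *)
case: (ex_minnP exM) => M iM minM.
have hC m : m < M -> cnt S m < i.
  by move=> lt; rewrite ltnNge; apply/negP => /minM; lia.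
have Mn : M <= n by apply: minM; rewrite (in_Sn_cnt hS).
have lowC m X : m < M -> uniq X -> (forall x, x \in X -> in_N (s_ j) x) ->
    (forall x, x \in X -> size x <= m) -> m + size X <= cnt S m + (j <= m).
  move=> mM; apply: leq_expansion_cnt eS _ _; first by lia.
    by lia.
  by have := hC _ mM; lia.
apply: (@no_dominating_counts n j M i (cnt S) (cnt S') (scnt S') (fun p => s_ p \in S')) => //.
- by move: Pi; rewrite /P (@prefix_sum_eq S i M) ?szS.
- have : ~~ P i.-1 by apply/negP => /mini; lia.
  rewrite /P (@prefix_sum_eq S i.-1 M) ?szS //; [|by lia..].
  by rewrite -leqNgt prednK.
- move=> L; apply: leq_trans (leq_prefix_sum _ _) _; first by rewrite szS'.
  by rewrite -(@prefix_sum_eq S i M) ?szS //; apply: dom; lia.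
(* From length 2j - 1 on, the first child makes up for the removed s_j. *)
- move=> m mM; case: (leqP j.*2.-1 m) => h.
    have [w Nw sw] := in_N_overlap j2.
    have := lowC m [:: w] mM isT; rewrite /= => H.
    suff : m + 1 <= cnt S m + (j <= m) by lia.
    by apply: H => x; rewrite inE => /eqP -> //; rewrite sw.
  by have := lowC m [::] mM isT; rewrite /= => /(_ _ _) H; rewrite andbT -[m in m <= _]addn0; apply: H.
- move=> m mM jm; have [u [v [Nu Nv uv vm]]] := in_N_two j2 jm.
  have := lowC m [:: u; v] mM; rewrite /= => H.
  suff : m + 2 <= cnt S m + (j <= m) by lia.
  apply: H.
  + by rewrite inE andbT; apply: contraTneq uv => ->; rewrite ltnn.
  + by move=> x; rewrite !inE => /orP[] /eqP ->.
  + by move=> x; rewrite !inE => /orP[] /eqP -> //; apply: leq_trans (ltnW uv) vm.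
- by move=> m K; apply: cnt_leq_sum_scnt hS'; lia.
- by move=> p m; apply: scnt_leq1 hS'.
- by move=> p m jp ps; apply: scnt_eq0 hS' _ ps; lia.
(* The stripped words serve as the family [X] of children counted in [S]. *)
- move=> p m jp ps mj mM; have [X [uX sX NX leX]] := scnt_embed hS' j2 jp ps mj.
  by have := lowC m X mM uX NX leX; rewrite sX; lia.
- by apply/negP => /(in_Sn_leq hS'); rewrite size_s // ltnn.
Qed.

Lemma first_difference n S S' : in_Sn n S -> in_Sn n S' -> lengths S' <> lengths S ->
  dominates n (lengths S') (lengths S) ->
  exists2 m0, (forall m, m < m0 -> cnt S m = cnt S' m) & cnt S m0 < cnt S' m0.
Proof.
move=> hS hS' neq dom.
have szS := in_Sn_size hS; have szS' := in_Sn_size hS'.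
have ex : exists m, cnt S m != cnt S' m.
  case: (boolP (all (fun m => cnt S m == cnt S' m) (iota 0 n))) => [/allP h | /allPn[m _ ?]]; last by exists m.
  case: neq; apply: eq_cnt_lengths => m; case: (ltnP m n) => mn.
    by apply/esym/eqP/h; rewrite mem_iota.
  by rewrite (in_Sn_cnt hS) // (in_Sn_cnt hS').
case: (ex_minnP ex) => m0 hm0 min0.
have eqC k : k < m0 -> cnt S k = cnt S' k.
  by move=> lt; apply/eqP; apply: contraLR lt => /min0; rewrite -leqNgt.
exists m0 => //; rewrite ltn_neqAle hm0 /= leqNgt; apply/negP => lt.
(* If [S] were ahead at [m0], its [i] smallest lengths would have a strictly smaller sum than those
   of [S']. *)
pose i := cnt S m0; have i_n : i <= n by rewrite -szS cnt_size.
have := dom i; rewrite (@prefix_sum_eq S i m0) ?szS // i_n andbT => /(_ ltac:(rewrite /i; lia)).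
have := @leq_prefix_sum S' i m0.+1; rewrite szS' => /(_ i_n).
rewrite big_ord_recr /= (eq_bigr (fun m : 'I_m0 => i - cnt S m)).
  by rewrite /i; lia.
by move=> k _; rewrite eqC.
Qed.

Theorem theorem7 (n : nat) (S : seq word) :
  5 <= n -> in_Sn n S -> R_implies n S ->
  sumn (lengths S) < n * (n + 1) %/ 2 ->
  in_Dn n S.
Proof.
move=> n5 hS [j [/andP[j0 jn] /= [uS szS eS minS]]] sumS; split=> // S' hS' neq dom.
(* Greedy form of minimality: an omitted candidate is at least as long as all [n] words of [S]. *)
have {}minS u : expansion n j u -> cnt S (size u) < n -> u \in S.
  move=> eu; apply: contraTT => uS'; rewrite -leqNgt (cnt_all _ (leqnn (size u))) ?szS //.
  by apply/allP => w wS; apply: minS eu uS' _ wS.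
have [m0 eqC ltC] := first_difference hS hS' neq dom.
have n2 : 2 <= n by lia.
have sS' := s_mem_of_cnt n2 (introT andP (conj j0 jn)) hS' uS eS minS eqC ltC.
case: (leqP 2 j) => j2.
  by apply: (not_dominates_expand n5 _ hS hS' minS sumS sS' dom); rewrite j2.
have ej : j = 1 by lia.
by subst j; apply: (not_dominates_expand0 n5 hS hS' minS _ dom); apply: sS'.
Qed.
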